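(* Let $K_p,K_d,K_i\in\mathbb{R}^{m\times p}$ be such that the closed loop of the system $$\dot x(t)=A_0x(t)+\sum_{k=1}^{K}A_kx(t-\tau_k)+Bu(t),\qquad y(t)=Cx(t),$$ with the PID control law $$u(t)=K_p\,y(t)+K_d\,\dot y(t)+K_i\int_0^t y(s)\,ds$$ is exponentially stable. For $T>0$ consider the closed loop of the same system with the low-pass filtered control law $$u(t)=K_p\,y(t)+K_d\,\zeta(t)+K_i\int_0^t y(s)\,ds,\qquad T\dot\zeta(t)+\zeta(t)=\dot y(t).$$ (i) If $BK_dC$ has an eigenvalue with real part larger than one, then there exists $\widehat T>0$ such that the filtered closed loop is unstable for all $T\in(0,\widehat T)$. (ii) If $BK_dC-I_n$ is Hurwitz, then there exists $\widehat T>0$ such that the filtered closed loop is exponentially stable for all $T\in(0,\widehat T)$.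
   Context: Data: $x(t)\in\mathbb{R}^n$, $u(t)\in\mathbb{R}^m$, $y(t)\in\mathbb{R}^p$; discrete delays $0<\tau_1<\dots<\tau_K<+\infty$; real matrices $A_0,\dots,A_K\in\mathbb{R}^{n\times n}$, $B\in\mathbb{R}^{n\times m}$ of full column rank, $C\in\mathbb{R}^{p\times n}$ of full row rank. A square matrix is Hurwitz if all its eigenvalues have negative real part. Let $q=\operatorname{rank}(K_i)$ and $K_i=U_iV_i$ with $U_i\in\mathbb{R}^{m\times q}$ of full column rank and $V_i\in\mathbb{R}^{q\times p}$ of full row rank (blocks of size $q$ are absent if $q=0$). Characteristic function of the nominal (unfiltered) closed loop: $$H_0(\lambda)=\det\left(\lambda\begin{bmatrix}I_n-BK_dC&0\\0&I_q\end{bmatrix}-\begin{bmatrix}A_0+BK_pC&BU_i\\ V_iC&0\end{bmatrix}-\sum_{k=1}^{K}\begin{bmatrix}A_k&0\\0&0\end{bmatrix}e^{-\lambda\tau_k}\right).$$ Characteristic function of the filtered closed loop: $$H_3(\lambda;T)=\det\left(\lambda\left(\begin{bmatrix}I_n&0\\0&I_q\end{bmatrix}-\frac{1}{\lambda T+1}\begin{bmatrix}BK_dC&0\\0&0\end{bmatrix}\right)-\begin{bmatrix}A_0+BK_pC&BU_i\\ V_iC&0\end{bmatrix}-\sum_{k=1}^{K}\begin{bmatrix}A_k&0\\0&0\end{bmatrix}e^{-\lambda\tau_k}\right).$$ A closed loop is exponentially stable if and only if all roots of its characteristic function lie in the open left half-plane, bounded away from the imaginary axis (i.e. there is $c>0$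 such that all roots satisfy $\Re(\lambda)\le -c$). It is unstable if its characteristic function has at least one root in the open right half-plane. *)

(* Defs.v *)
From HB Require Import structures.
From mathcomp Require Import all_boot all_order all_algebra.
From mathcomp Require Import complex.
From mathcomp Require Import reals sequences exp trigo.

Set Implicit Arguments.
Unset Strict Implicit.
Unset Printing Implicit Defensive.

Import Order.TTheory GRing.Theory Num.Theory.
Local Open Scope ring_scope.
Local Open Scope complex_scope.

Definition mxC (R : realType) (m n : nat) (M : 'M[R]_(m, n)) : 'M[R[i]]_(m, n) :=
  map_mx (fun x : R => x%:C) M.

Definition cexp (R : realType) (z : R[i]) : R[i] :=
  (expR (complex.Re z))%:C * (cos (complex.Im z) +i* sin (complex.Im z)).

Definition hurwitz (R : realType) (n : nat) (M : 'M[R]_n) : Prop :=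
  forall z : R[i], eigenvalue (mxC M) z -> complex.Re z < 0.

(* Exponential stability and instability of a closed loop are read off its
   characteristic function H. *)
Definition exp_stable (R : realType) (H : R[i] -> R[i]) : Prop :=
  exists c : R, 0 < c /\ forall z : R[i], H z = 0 -> complex.Re z <= - c.

Definition unstable (R : realType) (H : R[i] -> R[i]) : Prop :=
  exists z : R[i], H z = 0 /\ 0 < complex.Re z.

(* The delays tau_1, ..., tau_K and the matrices A_1, ..., A_K are indexed from
   0 by 'I_K; the undelayed matrix A_0 is the separate argument A0.  The
   integral gain enters through a factorization Ki = Ui *m Vi. *)

(* [A0 + B Kp C, B Ui; Vi C, 0] + sum_k [A_k, 0; 0, 0] exp (- z tau_k) *)
Definition loop_mx (R : realType) (n m p q K : nat)
    (A0 : 'M[R]_n) (A : 'I_K -> 'M[R]_n) (tau : 'I_K -> R)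
    (B : 'M[R]_(n, m)) (C : 'M[R]_(p, n)) (Kp : 'M[R]_(m, p))
    (Ui : 'M[R]_(m, q)) (Vi : 'M[R]_(q, p)) (z : R[i]) : 'M[R[i]]_(n + q) :=
  mxC (block_mx (A0 + B *m Kp *m C) (B *m Ui) (Vi *m C) 0)
  + \sum_(k < K) cexp (- z * (tau k)%:C) *: mxC (block_mx (A k) 0 0 0).

Definition char_nominal (R : realType) (n m p q K : nat)
    (A0 : 'M[R]_n) (A : 'I_K -> 'M[R]_n) (tau : 'I_K -> R)
    (B : 'M[R]_(n, m)) (C : 'M[R]_(p, n)) (Kp Kd : 'M[R]_(m, p))
    (Ui : 'M[R]_(m, q)) (Vi : 'M[R]_(q, p)) (z : R[i]) : R[i] :=
  \det (z *: mxC (block_mx (1%:M - B *m Kd *m C) 0 0 1%:M)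
        - loop_mx A0 A tau B C Kp Ui Vi z).

(* At the pole z = -1/T the inverse is 0 by convention, so the value there is
   meaningless; since -1/T is a fixed negative real, whether it is counted as
   a root affects neither exp_stable nor unstable. *)
Definition char_filtered (R : realType) (n m p q K : nat)
    (A0 : 'M[R]_n) (A : 'I_K -> 'M[R]_n) (tau : 'I_K -> R)
    (B : 'M[R]_(n, m)) (C : 'M[R]_(p, n)) (Kp Kd : 'M[R]_(m, p))
    (Ui : 'M[R]_(m, q)) (Vi : 'M[R]_(q, p)) (T : R) (z : R[i]) : R[i] :=
  \det (z *: (mxC (block_mx 1%:M 0 0 1%:M)
              - (z * T%:C + 1)^-1 *: mxC (block_mx (B *m Kd *m C) 0 0 0))
        - loop_mx A0 A tau B C Kp Ui Vi z).

(* Main.v *)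
Require Import Defs.
From mathcomp Require Import all_boot all_order all_algebra.
From mathcomp Require Import complex.
From mathcomp Require Import reals.
From mathcomp Require Import perm boolp classical_sets topology normedtype derive.
From mathcomp Require Import sequences exp trigo.
From mathcomp Require Import ring lra.

(** Write the closed loop as the matrix z (I - D / (z T + 1)) - L(z), where D is
    B Kd C padded with zeros and L collects the undelayed and delayed terms.  On
    each right half-plane Re z >= - c the exponentials, hence L, are bounded.

    Instability.  Put z = s / T.  After multiplication by (s + 1) T the matrix
    becomes s ((s + 1) I - D) - (s + 1) T L(s / T), and on a bounded part of
    Re s >= 0 the last term is O(T).  As T -> 0 the determinant tends uniformly
    there to s^N det ((s + 1) I - D), which vanishes at mu - 1 for every
    eigenvalue mu of D.  If Re mu > 1 this zero lies in the open right
    half-plane, and for small T the perturbed determinant still has a zero next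
    to it, giving a characteristic root of real part of order 1 / T
    (filtered_loop_unstable).

    Persistence of the zero (entire_has_zero) is the qualitative part of
    Rouche's theorem, obtained without contour integrals.  For a polynomial p
    without roots in a closed disk, multiply the values of p at the points
    a + rho w, w ranging over the N-th roots of unity: each root r of p
    contributes |rho^N - (r - a)^N| <= 2 |r - a|^N, so the product is at most
    2^deg(p) |p(a)|^N, and N > deg(p) yields a point of the circle where
    |p| <= 2 |p(a)| (poly_weak_min_modulus).  The constant 2 does not depend on
    the degree, so the statement passes to locally uniform limits of
    polynomials.  These limits form a class (entire) that contains cexp, as
    (1 + z / N)^N converges to it, and is closed under sums, products and
    determinants; so it contains all the determinants at hand.

    Stability.  Let - c be strictly to the right of all the nominal roots; the
    claim is that for small T no root has Re z > - c.  With v = z T + 1, small T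
    forces Re v >= 1 - d, a half-plane where det (I - D / v) is bounded away
    from 0 since the eigenvalues of D stay in Re < 1
    (det_scaled_resolvent_lower_bound).  Hence for |z| larger than some R0 the
    matrix divided by z, namely I - D / v - L(z) / z, is invertible.  For
    |z| <= R0 the filtered matrix tends uniformly to the nominal one, whose
    determinant has a positive lower bound on the compact box containing these
    z.  Both perturbation steps use that the determinant is uniformly continuous
    on bounded sets of matrices (det_close); see filtered_loop_stable. *)

Set Implicit Arguments.
Unset Strict Implicit.
Unset Printing Implicit Defensive.

Import Order.TTheory GRing.Theory Num.Theory numFieldNormedType.Exports.
Import Normc.
Local Open Scope ring_scope.
Local Open Scope complex_scope.

(** * The real-valued modulus on complex numbers *)

Lemma normc_ge0 (R : realType) (z : R[i]) : 0 <= normc z.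
Proof. by case: z => a b; rewrite /normc sqrtr_ge0. Qed.

Lemma normc_eq0 (R : realType) (z : R[i]) : (normc z == 0) = (z == 0).
Proof. by apply/eqP/eqP => [/eq0_normc //|->]; exact: normc0. Qed.

Lemma normc_gt0 (R : realType) (z : R[i]) : (0 < normc z) = (z != 0).
Proof. by rewrite lt_neqAle normc_ge0 andbT eq_sym normc_eq0. Qed.

Lemma normcC (R : realType) (x : R) : normc x%:C = `|x|.
Proof. by rewrite /= expr0n addr0 sqrtr_sqr. Qed.

Lemma normcX (R : realType) (z : R[i]) k : normc (z ^+ k) = normc z ^+ k.
Proof. by elim: k => [|k IH]; rewrite ?expr0 ?normc1 // !exprS normcM IH. Qed.

Lemma normcB (R : realType) (x y : R[i]) : normc (x - y) = normc (y - x).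
Proof. by rewrite -normcN opprB. Qed.

Lemma normc_trisub (R : realType) (y x z : R[i]) :
  normc (x - z) <= normc (x - y) + normc (y - z).
Proof.
by apply: le_trans (le_normcD _ _); rewrite addrA subrK.
Qed.

Lemma lerB_normc (R : realType) (x y : R[i]) :
  normc x - normc y <= normc (x - y).
Proof. by rewrite lerBlDr -{1}(subrK y x) le_normcD. Qed.

Lemma normc_sum (R : realType) I (r : seq I) (P : pred I) (F : I -> R[i]) :
  normc (\sum_(i <- r | P i) F i) <= \sum_(i <- r | P i) normc (F i).
Proof.
elim/big_ind2: _ => [|x u y v lexu leyv|//]; first by rewrite normc0.
exact: le_trans (le_normcD _ _) (lerD _ _).
Qed.

Lemma normc_prod (R : realType) I (r : seq I) (P : pred I) (F : I -> R[i]) :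
  normc (\prod_(i <- r | P i) F i) = \prod_(i <- r | P i) normc (F i).
Proof. exact: (big_morph _ (@normcM R) (@normc1 R)). Qed.

Lemma normr_Re_le (R : realType) (z : R[i]) : `|complex.Re z| <= normc z.
Proof.
by case: z => a b /=; rewrite -sqrtr_sqr ler_wsqrtr // lerDl sqr_ge0.
Qed.

Lemma normr_Im_le (R : realType) (z : R[i]) : `|complex.Im z| <= normc z.
Proof.
by case: z => a b /=; rewrite -sqrtr_sqr ler_wsqrtr // lerDr sqr_ge0.
Qed.

Lemma Re_le_normc (R : realType) (z : R[i]) : complex.Re z <= normc z.
Proof. exact: le_trans (ler_norm _) (normr_Re_le z). Qed.

Lemma normc_le_ReIm (R : realType) (z : R[i]) :
  normc z <= `|complex.Re z| + `|complex.Im z|.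
Proof.
case: z => a b /=; rewrite -[leRHS]ger0_norm ?addr_ge0 // -sqrtr_sqr.
rewrite ler_wsqrtr // sqrrD !real_normK ?num_real // addrAC lerDl.
by rewrite mulrn_wge0 ?mulr_ge0.
Qed.

(** * A weak minimum modulus principle for polynomials *)

(** One constant serves for the size and for the Lipschitz bound on a disk,
    which is what the induction on the polynomial needs. *)
Lemma horner_lipschitz (R : realType) (p : {poly R[i]}) (r : R) :
  exists M : R, 0 <= M /\ forall z w : R[i], normc z <= r -> normc w <= r ->
    normc p.[z] <= M /\ normc (p.[z] - p.[w]) <= M * normc (z - w).
Proof.
elim/poly_ind: p => [|p c [M [M0 HM]]].
  by exists 0; split=> // z w _ _; rewrite !horner0 subr0 normc0 mul0r.
have [r0|r0] := ltP r 0.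
  exists 0; split=> // z w zr; have := normc_ge0 z.
  by rewrite leNgt (le_lt_trans zr r0).
exists (M * r + normc c + M); split.
  by rewrite !addr_ge0 ?mulr_ge0 ?normc_ge0.
move=> z w zr wr; have [pz pzw] := HM z w zr wr; have [pw _] := HM w z wr zr.
have Mr : 0 <= M * r by rewrite mulr_ge0.
have nc := normc_ge0 c.
rewrite !hornerE; split.
  apply: le_trans (le_normcD _ _) _; rewrite normcM.
  have : normc p.[z] * normc z <= M * r by rewrite ler_pM ?normc_ge0.
  by move: M0; lra.
have -> : p.[z] * z + c - (p.[w] * w + c) = (p.[z] - p.[w]) * z + p.[w] * (z - w).
  by ring.
apply: le_trans (le_normcD _ _) _; rewrite !normcM.
have nzw := normc_ge0 (z - w).
have h1 : normc (p.[z] - p.[w]) * normc z <= (M * normc (z - w)) * r.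
  by rewrite ler_pM ?normc_ge0.
have h2 : normc p.[w] * normc (z - w) <= M * normc (z - w) by rewrite ler_wpM2r.
have h3 : 0 <= normc c * normc (z - w) by rewrite mulr_ge0.
rewrite !mulrDl; move: h1 h2 h3; rewrite mulrAC; lra.
Qed.

Lemma prodr_const_seq (V : comPzSemiRingType) I (r : seq I) (x : V) :
  \prod_(i <- r) x = x ^+ size r.
Proof. by rewrite big_const_seq count_predT iter_mulr_1. Qed.

(** With N > deg p, the mean of log |p| over N equidistant points of the circle
    is compared with log |p(a)|: the product over the points factors through the
    roots r of p, each giving |rho^N - (r - a)^N|, which is at most
    2 |r - a|^N for r outside the disk.  Since the total loss 2^(deg p) is
    spread over N points, the factor 2 is independent of p. *)
Lemma poly_weak_min_modulus (R : realType) (p : {poly R[i]}) (a : R[i]) (rho m : R) :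
  0 < rho -> (forall z, normc (z - a) = rho -> m <= normc p.[z]) ->
  2 * normc p.[a] < m ->
  exists2 z, normc (z - a) <= rho & root p z.
Proof.
move=> rho0 onC pa_small; have m0 : 0 < m.
  by apply: le_lt_trans pa_small; rewrite mulr_ge0 ?normc_ge0.
have [rs def_p] := closed_field_poly_normal p.
set c := lead_coef p in def_p.
apply: contrapT => noroot.
have c0 : c != 0.
  rewrite lead_coef_eq0; apply/negP => /eqP p0; apply: noroot.
  by exists a; rewrite ?p0 ?root0 // subrr normc0 ltW.
have far r : r \in rs -> rho < normc (r - a).
  move=> rin; rewrite ltNge; apply/negP => ra; apply: noroot; exists r => //.
  by rewrite def_p rootZ // root_prod_XsubC.
set N := (size rs).+1.
(* The sample points on the circle are a + rho w for w in ws, the N-th roots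
   of unity. *)
have [ws def_q] := closed_field_poly_normal ('X^N - 1 : {poly R[i]}).
rewrite (monicP (monicXnsubC _ (ltn0Sn _))) scale1r in def_q.
have evq x : x ^+ N - 1 = \prod_(w <- ws) (x - w).
  have := congr1 (horner^~ x) def_q; rewrite /= !hornerE horner_prod => ->.
  by apply: eq_bigr => w _; rewrite !hornerE.
have szws : size ws = N.
  have := congr1 (fun q : {poly R[i]} => size q) def_q.
  by rewrite size_prod_XsubC size_XnsubC // => -[].
have w1 w : w \in ws -> normc w = 1.
  move=> win; have : root ('X^N - 1) w by rewrite def_q root_prod_XsubC.
  rewrite rootE !hornerE subr_eq0 => /eqP wN.
  apply/eqP; rewrite -(@pexpr_eq1 _ _ N) ?normc_ge0 //.
  by rewrite -normcX wN normc1.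
have rho0C : rho%:C != 0 by rewrite (fmorph_eq0 (real_complex R)) gt_eqF.
have prodw r : r \in rs ->
    normc (\prod_(w <- ws) (a + rho%:C * w - r)) <= 2 * normc (r - a) ^+ N.
  move=> rin.
  (* (- rho)^N ((b / rho)^N - 1), with b = r - a, has modulus |b^N - rho^N|. *)
  have -> : \prod_(w <- ws) (a + rho%:C * w - r)
      = (- rho%:C) ^+ N * (((r - a) / rho%:C) ^+ N - 1).
    rewrite evq -szws -prodr_const_seq -big_split /=; apply: eq_bigr => w _.
    by field.
  rewrite exprNn -mulrA normcM normcX normcN normc1 expr1n mul1r.
  rewrite mulrBr mulr1 -exprMn mulrC divfK //.
  apply: le_trans (le_normcD _ _) _; rewrite normcN !normcX mulr2n mulrDl mul1r.
  rewrite lerD2l lerXn2r ?nnegrE ?normc_ge0 // normcC gtr0_norm //.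
  exact/ltW/far.
have lower : m ^+ N <= normc (\prod_(w <- ws) p.[a + rho%:C * w]).
  rewrite normc_prod -szws -prodr_const_seq big_seq [leRHS]big_seq.
  apply: ler_prod => w win; rewrite ltW //=; apply: onC.
  by rewrite addrC addKr normcM (w1 _ win) mulr1 normcC gtr0_norm.
have upper : normc (\prod_(w <- ws) p.[a + rho%:C * w])
    <= (2 * normc p.[a]) ^+ N.
  have -> : \prod_(w <- ws) p.[a + rho%:C * w]
      = c ^+ N * \prod_(r <- rs) \prod_(w <- ws) (a + rho%:C * w - r).
    rewrite exchange_big -szws -prodr_const_seq -big_split /=.
    apply: eq_bigr => w _; rewrite {1}def_p hornerZ horner_prod.
    by congr (_ * _); apply: eq_bigr => r _; rewrite !hornerE.
  rewrite normcM normcX normc_prod.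
  have -> : normc p.[a] = normc c * \prod_(r <- rs) normc (r - a).
    rewrite {1}def_p hornerZ horner_prod normcM normc_prod; congr (_ * _).
    by apply: eq_bigr => r _; rewrite !hornerE normcB.
  rewrite mulrCA exprMn ler_wpM2l ?exprn_ge0 ?normc_ge0 //.
  apply: (@le_trans _ _ (\prod_(r <- rs) (2 * normc (r - a) ^+ N))).
    rewrite big_seq [leRHS]big_seq; apply: ler_prod => r rin.
    by rewrite normc_ge0 prodw.
  rewrite big_split /= prodr_const_seq exprMn -prodrXl.
  rewrite ler_wpM2r ?prodr_ge0 // => [r _|]; first by rewrite exprn_ge0 ?normc_ge0.
  by rewrite ler_weXn2l // ler1n.
have := le_trans lower upper; rewrite leNgt ltrXn2r ?nnegrE //.
by rewrite mulr_ge0 ?normc_ge0.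
Qed.

(** * Entire functions as locally uniform limits of polynomials *)

(** By Taylor expansion in one direction and Weierstrass' theorem in the other,
    these are exactly the functions holomorphic on the whole plane.  The
    approximation form is chosen because zeros and bounds of polynomials carry
    over to it directly. *)
Definition entire (R : realType) (f : R[i] -> R[i]) : Prop :=
  forall r e : R, 0 < e -> exists p : {poly R[i]},
    forall z, normc z <= r -> normc (f z - p.[z]) <= e.

Lemma entire_horner (R : realType) (p : {poly R[i]}) : entire (horner p).
Proof.
by move=> r e e0; exists p => z _; rewrite subrr normc0 ltW.
Qed.

Lemma eq_entire (R : realType) (f g : R[i] -> R[i]) :
  f =1 g -> entire f -> entire g.
Proof. by move=> /funext ->. Qed.

Lemma entire_cst (R : realType) (a : R[i]) : entire (fun=> a).
Proof. by apply: eq_entire (entire_horner a%:P) => z; rewrite hornerC. Qed.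

Lemma entire_id (R : realType) : entire (id : R[i] -> R[i]).
Proof. by apply: eq_entire (entire_horner 'X) => z; rewrite hornerX. Qed.

Lemma entire_bounded (R : realType) (f : R[i] -> R[i]) (r : R) : entire f ->
  exists M : R, 0 <= M /\ forall z, normc z <= r -> normc (f z) <= M.
Proof.
move=> /(_ r 1 ltr01) [p fp]; have [M [M0 pM]] := horner_lipschitz p r.
exists (M + 1); split=> [|z zr]; first by rewrite addr_ge0.
have [pz _] := pM z z zr zr; have := fp z zr.
have := le_normcD (f z - p.[z]) p.[z]; rewrite subrK; lra.
Qed.

Lemma entireD (R : realType) (f g : R[i] -> R[i]) :
  entire f -> entire g -> entire (fun z => f z + g z).
Proof.
move=> ef eg r e e0; have e2 : 0 < e / 2 by rewrite divr_gt0.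
have [p fp] := ef r _ e2; have [q gq] := eg r _ e2.
exists (p + q) => z zr; rewrite hornerD opprD addrACA.
apply: le_trans (le_normcD _ _) _; have := fp z zr; have := gq z zr; lra.
Qed.

Lemma entireM (R : realType) (f g : R[i] -> R[i]) :
  entire f -> entire g -> entire (fun z => f z * g z).
Proof.
move=> ef eg r e e0.
have [M [M0 fM]] := entire_bounded r ef.
have [L [L0 gL]] := entire_bounded r eg.
have S0 : 0 < M + L + 1 by lra.
pose d := Num.min 1 (e / (M + L + 1)).
have d0 : 0 < d by rewrite lt_min ltr01 divr_gt0.
have d1 : d <= 1 by rewrite ge_min lexx.
have dS : d * (M + L + 1) <= e by rewrite -ler_pdivlMr // ge_min lexx orbT.
have [p fp] := ef r _ d0; have [q gq] := eg r _ d0.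
exists (p * q) => z zr; rewrite hornerM.
have -> : f z * g z - p.[z] * q.[z] = f z * (g z - q.[z]) + q.[z] * (f z - p.[z]).
  by ring.
apply: le_trans (le_normcD _ _) _; rewrite !normcM.
have h1 : normc (f z) * normc (g z - q.[z]) <= M * d.
  by rewrite ler_pM ?normc_ge0 ?fM ?gq.
have qz : normc q.[z] <= L + 1.
  have := gL z zr; have := gq z zr; have := lerB_normc q.[z] (g z).
  rewrite normcB; lra.
have h2 : normc q.[z] * normc (f z - p.[z]) <= (L + 1) * d.
  by rewrite ler_pM ?normc_ge0 ?fp.
apply: le_trans dS; apply: le_trans (lerD h1 h2) _.
by rewrite -mulrDl mulrC addrA.
Qed.

Lemma entireN (R : realType) (f : R[i] -> R[i]) :
  entire f -> entire (fun z => - f z).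
Proof.
move=> ef; have := entireM (entire_cst (-1)) ef.
by apply: eq_entire => z; rewrite mulN1r.
Qed.

Lemma entireB (R : realType) (f g : R[i] -> R[i]) :
  entire f -> entire g -> entire (fun z => f z - g z).
Proof. by move=> ef eg; exact: entireD ef (entireN eg). Qed.

Lemma entire_sum (R : realType) I (r : seq I) (F : I -> R[i] -> R[i]) :
  (forall i, entire (F i)) -> entire (fun z => \sum_(i <- r) F i z).
Proof.
move=> eF; elim: r => [|i r IH].
  by apply: eq_entire (entire_cst 0) => z; rewrite big_nil.
by apply: eq_entire (entireD (eF i) IH) => z; rewrite big_cons.
Qed.

Lemma entire_prod (R : realType) I (r : seq I) (F : I -> R[i] -> R[i]) :
  (forall i, entire (F i)) -> entire (fun z => \prod_(i <- r) F i z).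
Proof.
move=> eF; elim: r => [|i r IH].
  by apply: eq_entire (entire_cst 1) => z; rewrite big_nil.
by apply: eq_entire (entireM (eF i) IH) => z; rewrite big_cons.
Qed.

Lemma entire_det (R : realType) n (F : R[i] -> 'M[R[i]]_n) :
  (forall i j, entire (fun z => F z i j)) -> entire (fun z => \det (F z)).
Proof.
move=> eF; apply: entire_sum => s; apply: entireM; first exact: entire_cst.
by apply: entire_prod => i; exact: eF.
Qed.

Lemma entire_scale (R : realType) (f : R[i] -> R[i]) (a : R[i]) :
  entire f -> entire (fun z => f (a * z)).
Proof.
move=> ef r e e0; have [p fp] := ef (normc a * r) e e0.
exists (p \Po (a *: 'X)) => z zr; rewrite horner_comp hornerZ hornerX.
by apply: fp; rewrite normcM ler_wpM2l ?normc_ge0.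
Qed.

Lemma entire_continuous (R : realType) (f : R[i] -> R[i]) (z0 : R[i]) (e : R) :
  entire f -> 0 < e -> exists2 d : R, 0 < d &
    forall w, normc (w - z0) < d -> normc (f w - f z0) < e.
Proof.
move=> ef e0; have e4 : 0 < e / 4 by rewrite divr_gt0.
have [p fp] := ef (normc z0 + 1) _ e4.
have [M [M0 pM]] := horner_lipschitz p (normc z0 + 1).
exists (Num.min 1 (e / 4 / (M + 1))).
  by rewrite lt_min ltr01 divr_gt0 //; lra.
move=> w; rewrite lt_min => /andP[w1 wM].
have z0r : normc z0 <= normc z0 + 1 by lra.
have wr : normc w <= normc z0 + 1 by have := lerB_normc w z0; lra.
have [_ lip] := pM w z0 wr z0r.
have h : M * normc (w - z0) <= e / 4.
  apply: (@le_trans _ _ ((M + 1) * normc (w - z0))).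
    by rewrite ler_wpM2r ?normc_ge0 //; lra.
  by rewrite mulrC -ler_pdivlMr ?(ltW wM) //; lra.
have := fp w wr; have := fp z0 z0r; have := normc_trisub p.[w] (f w) (f z0).
have := normc_trisub p.[z0] p.[w] (f z0); rewrite (normcB p.[z0]); lra.
Qed.

(** * The complex exponential is entire *)

Lemma sin_meanE (R : realType) (b : R) :
  exists2 c : R, `|c| <= `|b| & sin b = cos c * b.
Proof.
wlog b0 : b / 0 <= b => [wl|].
  have [/wl //|bn] := leP 0 b.
  have [|c cb sc] := wl (- b); first by rewrite oppr_ge0 ltW.
  exists c; first by rewrite -(normrN b).
  by apply: oppr_inj; rewrite -sinN sc mulrN.
have [|c cin] := @MVT_segment R (@sin R) (@cos R) 0 b b0.
  exact/continuous_subspaceT/continuous_sin.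
rewrite sin0 !subr0 => sb; exists c => //.
by move: cin; rewrite in_itv /= => /andP[c0 cb]; rewrite !ger0_norm.
Qed.

Lemma cos_meanE (R : realType) (b : R) :
  exists2 c : R, `|c| <= `|b| & cos b - 1 = - sin c * b.
Proof.
wlog b0 : b / 0 <= b => [wl|].
  have [/wl //|bn] := leP 0 b.
  have [|c cb sc] := wl (- b); first by rewrite oppr_ge0 ltW.
  exists (- c); first by rewrite normrN -(normrN b).
  by rewrite -cosN sc sinN; ring.
have [|c cin] := @MVT_segment R (@cos R) (fun x => - sin x) 0 b b0.
  exact/continuous_subspaceT/continuous_cos.
rewrite cos0 !subr0 => sb; exists c => //.
by move: cin; rewrite in_itv /= => /andP[c0 cb]; rewrite !ger0_norm.
Qed.

Lemma normr_sin_le (R : realType) (b : R) : `|sin b| <= `|b|.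
Proof.
have [c _ ->] := sin_meanE b; rewrite normrM -[leRHS]mul1r ler_wpM2r //.
exact: cos_max.
Qed.

Lemma normr_cosB1_le (R : realType) (b : R) : `|cos b - 1| <= `|b| ^+ 2.
Proof.
have [c cb ->] := cos_meanE b; rewrite normrM normrN expr2 ler_wpM2r //.
exact: le_trans (normr_sin_le c) cb.
Qed.

Lemma normr_sinB_le (R : realType) (b : R) : `|b| <= 1 ->
  `|sin b - b| <= `|b| ^+ 2.
Proof.
move=> b1; have [c cb ->] := sin_meanE b.
rewrite -[X in _ - X]mul1r -mulrBl normrM expr2 ler_wpM2r //.
apply: le_trans (normr_cosB1_le c) _; rewrite expr2.
have := normr_ge0 c; have := normr_ge0 b; nra.
Qed.

Lemma expR_taylor1 (R : realType) (a : R) : `|a| <= 2^-1 ->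
  `|expR a - 1 - a| <= 2 * `|a| ^+ 2.
Proof.
move=> a2; have [l1 l2] : -2^-1 <= a /\ a <= 2^-1 by apply/andP; rewrite -ler_norml.
have h1 := expR_ge1Dx a; have h2 := expR_ge1Dx (- a).
have h3 := expRxMexpNx_1 a; have h4 := expR_gt0 a.
rewrite real_normK ?num_real // ger0_norm; last by lra.
have h5 : expR a * (1 - a) <= 1 by rewrite -[leRHS]h3 ler_wpM2l // ltW.
rewrite -subr_ge0.
have -> : 2 * a ^+ 2 - (expR a - 1 - a) = (1 + a + 2 * a ^+ 2) - expR a by ring.
rewrite subr_ge0 -(@ler_pM2r _ (1 - a)); last by lra.
apply: le_trans h5 _; rewrite -subr_ge0.
have -> : (1 + a + 2 * a ^+ 2) * (1 - a) - 1 = a ^+ 2 * (1 - 2 * a) by ring.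
by rewrite mulr_ge0 ?sqr_ge0 //; lra.
Qed.

Lemma normc_cexp (R : realType) (z : R[i]) :
  normc (cexp z) = expR (complex.Re z).
Proof.
rewrite /cexp normcM normcC ger0_norm ?expR_ge0 //=.
by rewrite cos2Dsin2 sqrtr1 mulr1.
Qed.

Lemma cexpD (R : realType) (x y : R[i]) : cexp (x + y) = cexp x * cexp y.
Proof.
case: x => a b; case: y => c d; rewrite /cexp /= expRD sinD cosD.
by apply/eqP; rewrite eq_complex /=; apply/andP; split; apply/eqP; ring.
Qed.

Lemma cexp0 (R : realType) : cexp (0 : R[i]) = 1.
Proof.
by rewrite /cexp /= expR0 cos0 sin0 mul1r.
Qed.

Lemma cexpMn (R : realType) (z : R[i]) n : cexp (z *+ n) = cexp z ^+ n.
Proof.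
by elim: n => [|n IH]; rewrite ?mulr0n ?cexp0 ?expr0 // mulrS cexpD IH exprS.
Qed.

(** The remainder has to be of second order: the error of (1 + z / N)^N is about
    N times the remainder at z / N. *)
Lemma cexp_taylor1 (R : realType) (w : R[i]) : normc w <= 2^-1 ->
  normc (cexp w - 1 - w) <= 8 * normc w ^+ 2.
Proof.
move=> w2; have aw := normr_Re_le w; have bw := normr_Im_le w.
apply: le_trans (normc_le_ReIm _) _.
have [W defW] : exists W : R, W = normc w by exists (normc w).
rewrite -defW in w2 aw bw *.
case: w {defW} w2 aw bw => a b w2 aw bw; rewrite /cexp /= in aw bw *.
have a2 := le_trans aw w2; have b2 := le_trans bw w2.
have e1 := expR_taylor1 a2; have s1 := normr_sin_le b.
have c1 := normr_cosB1_le b; have s2 := @normr_sinB_le R b ltac:(lra).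
have E2 : expR a <= 2.
  have := expR_ge1Dx (- a); have := expRxMexpNx_1 a; have := expR_gt0 a.
  have := ler_norm a; nra.
have E0 := expR_gt0 a; have a0 := normr_ge0 a; have b0 := normr_ge0 b.
have A2 : `|a| ^+ 2 <= W ^+ 2 by rewrite lerXn2r ?nnegrE //; lra.
have B2 : `|b| ^+ 2 <= W ^+ 2 by rewrite lerXn2r ?nnegrE //; lra.
have AB : `|a| * `|b| <= W ^+ 2 by rewrite expr2 ler_pM.
rewrite !(mul0r, mulr0, subr0, addr0, oppr0).
have -> : expR a * cos b - 1 - a = (expR a - 1 - a) + expR a * (cos b - 1) by ring.
have -> : expR a * sin b - b = (expR a - 1) * sin b + (sin b - b) by ring.
have h1 : `|expR a * (cos b - 1)| <= 2 * W ^+ 2.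
  by rewrite normrM (ger0_norm (ltW E0)) ler_pM ?(ltW E0) ?(le_trans c1).
have e3 : `|expR a - 1| <= 2 * `|a|.
  have := ler_normD (expR a - 1 - a) a; rewrite subrK; nra.
have h2 : `|(expR a - 1) * sin b| <= 2 * W ^+ 2.
  rewrite normrM; apply: (@le_trans _ _ (2 * `|a| * `|b|)).
    by rewrite ler_pM.
  by rewrite -mulrA ler_pM2l.
have := ler_normD (expR a - 1 - a) (expR a * (cos b - 1)).
have := ler_normD ((expR a - 1) * sin b) (sin b - b).
have W2 := sqr_ge0 W; lra.
Qed.

(** The approximants are (1 + z / N)^N.  With w = z / N, the identity
    A^N - B^N = (A - B) sum_i A^(N-1-i) B^i for A = cexp w and B = 1 + w, both
    of modulus at most exp |w|, bounds the error by 8 r^2 exp(r) / N. *)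
Lemma entire_cexp (R : realType) : entire (@cexp R).
Proof.
move=> r e e0; have [r0|r0] := ltP r 0.
  exists 0 => z zr; have := normc_ge0 z; lra.
pose K := 8 * r ^+ 2 * expR r.
have K0 : 0 <= K by rewrite !mulr_ge0 ?sqr_ge0 ?expR_ge0.
pose N := (Num.truncn (K / e + 2 * r)).+1.
have NK : K / e + 2 * r < N%:R by rewrite truncnS_gt.
have Ke : 0 <= K / e by rewrite divr_ge0 // ltW.
have N0 : 0 < N%:R :> R by [].
exists ((1 + N%:R^-1 *: 'X) ^+ N) => z zr.
rewrite horner_exp hornerD hornerZ hornerX hornerC.
set w := N%:R^-1 * z.
have NwE : z = w *+ N by rewrite -mulr_natl /w mulrA divff ?mul1r // pnatr_eq0.
have nw : normc w * N%:R = normc z.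
  by rewrite [in RHS]NwE normcMn mulr_natr.
have wr : normc w <= r / N%:R by rewrite ler_pdivlMr // nw.
have w2 : normc w <= 2^-1.
  by apply: le_trans wr _; rewrite ler_pdivrMr //; lra.
rewrite [in X in normc X]NwE cexpMn subrXX normcM.
have A1 : normc (cexp w - (1 + w)) <= 8 * (r / N%:R) ^+ 2.
  rewrite opprD addrA; apply: le_trans (cexp_taylor1 w2) _.
  rewrite ler_pM2l // lerXn2r ?nnegrE ?normc_ge0 //.
  exact: le_trans (normc_ge0 _) wr.
have w0 := normc_ge0 w.
have A2 : normc (\sum_(i < N) cexp w ^+ (N.-1 - i) * (1 + w) ^+ i)
    <= N%:R * expR r.
  apply: le_trans (normc_sum _ _ _) _.
  rewrite mulr_natl -[in leRHS](card_ord N) -sumr_const; apply: ler_sum => i _.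
  rewrite normcM !normcX normc_cexp.
  apply: (@le_trans _ _ (expR (normc w) ^+ (N.-1 - i) * expR (normc w) ^+ i)).
    apply: ler_pM; rewrite ?exprn_ge0 ?expR_ge0 ?normc_ge0 //.
      by rewrite lerXn2r ?nnegrE ?expR_ge0 // ler_expR Re_le_normc.
    rewrite lerXn2r ?nnegrE ?expR_ge0 ?normc_ge0 //.
    apply: le_trans (le_normcD _ _) _; rewrite normc1; exact: expR_ge1Dx.
  rewrite -exprD -expRM_natr ler_expR subnK; last by have := ltn_ord i; rewrite /N.
  apply: le_trans zr; rewrite -nw ler_wpM2l // ler_nat.
  exact: leq_pred.
apply: (@le_trans _ _ (8 * (r / N%:R) ^+ 2 * (N%:R * expR r))).
  by rewrite ler_pM ?normc_ge0.
have -> : 8 * (r / N%:R) ^+ 2 * (N%:R * expR r) = K / N%:R.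
  by rewrite /K; field; rewrite pnatr_eq0.
by rewrite ler_pdivrMr // mulrC -ler_pdivrMr //; lra.
Qed.

(** * Lower bounds and zeros of entire functions *)

(** Compactness of the box: the sets where |f| < m would otherwise generate a
    proper filter, and f would vanish at a cluster point of it. *)
Lemma entire_box_lower_bound (R : realType) (f : R[i] -> R[i]) (a b c d : R) :
  entire f ->
  (forall z, a <= complex.Re z <= b -> c <= complex.Im z <= d -> f z != 0) ->
  exists2 m : R, 0 < m &
    forall z, a <= complex.Re z <= b -> c <= complex.Im z <= d -> m <= normc (f z).
Proof.
move=> ef f_neq0; apply: contrapT => no_bound.
pose S (m : R) : set (R * R) :=
  fun xy => [/\ a <= xy.1 <= b, c <= xy.2 <= d & normc (f (xy.1 +i* xy.2)) < m].
pose F := filter_from (fun m : R => 0 < m : Prop) S.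
have PF : ProperFilter F.
  apply: filter_from_proper; last first.
    move=> m /= m0; apply: contrapT => Sm0; apply: no_bound.
    exists m => // -[x y] xab ycd; rewrite leNgt; apply/negP => fm.
    by apply: Sm0; exists (x, y).
  apply: filter_from_filter; first by exists 1 => /=.
  move=> m1 m2 /= m10 m20; exists (Num.min m1 m2); first by rewrite /= lt_min m10.
  by move=> xy [h1 h2]; rewrite lt_min => /andP[h3 h4].
have Fbox : F (`[a, b]%classic `*` `[c, d]%classic)%classic.
  by exists 1 => //= -[x y] [xab ycd _]; split; rewrite /= in_itv.
have [[x y] [[/= xab ycd] cl]] := compact_setX (@segment_compact R a b)
  (@segment_compact R c d) PF Fbox.
move: xab ycd; rewrite !in_itv /= => xab ycd.
have f0 := f_neq0 (x +i* y) xab ycd.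
have e0 : 0 < normc (f (x +i* y)) / 2 by rewrite divr_gt0 ?normc_gt0.
have [dl dl0 cont] := entire_continuous (x +i* y) ef e0.
have FS : F (S (normc (f (x +i* y)) / 2)) by exists (normc (f (x +i* y)) / 2).
have dl2 : 0 < dl / 2 by rewrite divr_gt0.
have [[x' y'] [[/= _ _ small] [/= bx by_]]] :=
  cl _ _ FS (nbhsx_ballx ((x, y) : R * R) _ dl2).
move: bx by_; rewrite -!ball_normE /= => bx by_.
have near : normc ((x' +i* y') - (x +i* y)) < dl.
  apply: le_lt_trans (normc_le_ReIm _) _ => /=.
  rewrite [in X in X + _]distrC [in X in _ + X]distrC; lra.
have := cont _ near; rewrite normcB.
have := lerB_normc (f (x +i* y)) (f (x' +i* y')); lra.
Qed.

(** If f had no zero in the square around the disk, |f| would be at least some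
    mu > 0 there; a polynomial close enough to f would then have no root in the
    disk, against [poly_weak_min_modulus].  Of the location of the zero only
    the real part is recorded, as this is what instability reads. *)
Lemma entire_has_zero (R : realType) (f : R[i] -> R[i]) (a : R[i]) (rho m : R) :
  entire f -> 0 < rho -> (forall z, normc (z - a) = rho -> m <= normc (f z)) ->
  2 * normc (f a) < m ->
  exists2 z, complex.Re a - rho <= complex.Re z & f z = 0.
Proof.
move=> ef rho0 onC fa_small; apply: contrapT => nozero.
have [|mu mu0 f_ge] := @entire_box_lower_bound R f (complex.Re a - rho)
    (complex.Re a + rho) (complex.Im a - rho) (complex.Im a + rho) ef.
  move=> z /andP[z1 _] _; apply/eqP => fz0; apply: nozero; by exists z.
pose e := Num.min (mu / 2) ((m - 2 * normc (f a)) / 4).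
have e0 : 0 < e by rewrite lt_min; apply/andP; split; lra.
have e1 : e <= mu / 2 by rewrite ge_min lexx.
have e2 : e <= (m - 2 * normc (f a)) / 4 by rewrite ge_min lexx orbT.
have [p fp] := ef (normc a + rho) _ e0.
have inball z : normc (z - a) <= rho -> normc z <= normc a + rho.
  by move=> za; have := lerB_normc z a; lra.
have [z zC||z za /rootP pz] := @poly_weak_min_modulus R p a rho (m - e) rho0.
- have := fp z (inball z ltac:(by rewrite zC)); have := onC z zC.
  by have := lerB_normc (f z) p.[z]; have := lerB_normc (f z) (f z - p.[z]);
     rewrite subKr; lra.
- have := fp a (inball a ltac:(by rewrite subrr normc0 ltW)).
  have := lerB_normc p.[a] (f a); rewrite normcB; lra.
have := fp z (inball z za); rewrite pz subr0.
have re := le_trans (normr_Re_le (z - a)) za.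
have im := le_trans (normr_Im_le (z - a)) za.
have /f_ge h : complex.Re a - rho <= complex.Re z <= complex.Re a + rho.
  by move: re; case: (z) (a) => [x1 y1] [x2 y2] /=; rewrite ler_distlC => /andP[]; lra.
have /h : complex.Im a - rho <= complex.Im z <= complex.Im a + rho.
  by move: im; case: (z) (a) => [x1 y1] [x2 y2] /=; rewrite ler_distlC => /andP[]; lra.
lra.
Qed.

(** * Uniform continuity of the determinant *)

Lemma prod_lipschitz (R : realType) I (r : seq I) (F G : I -> R[i]) (c d : R) :
  1 <= c -> 0 <= d -> (forall i, normc (F i) <= c) -> (forall i, normc (G i) <= c) ->
  (forall i, normc (F i - G i) <= d) ->
  normc (\prod_(i <- r) F i - \prod_(i <- r) G i) <= d * ((size r)%:R * c ^+ size r).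
Proof.
move=> c1 d0 Fc Gc FG; have c0 : 0 <= c by lra.
elim: r => [|i r IH]; first by rewrite !big_nil subrr normc0 mul0r mulr0.
rewrite !big_cons /=; set PF := \prod_(j <- r) F j in IH *.
set PG := \prod_(j <- r) G j in IH *.
have PGc : normc PG <= c ^+ size r.
  rewrite normc_prod -prodr_const_seq; apply: ler_prod => j _.
  by rewrite normc_ge0 Gc.
have -> : F i * PF - G i * PG = F i * (PF - PG) + (F i - G i) * PG by ring.
apply: le_trans (le_normcD _ _) _; rewrite !normcM.
apply: (@le_trans _ _ (c * (d * ((size r)%:R * c ^+ size r)) + d * c ^+ size r)).
  by rewrite lerD // ler_pM ?normc_ge0.
rewrite -natr1 exprS -subr_ge0.
have -> : d * (((size r)%:R + 1) * (c * c ^+ size r)) -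
  (c * (d * ((size r)%:R * c ^+ size r)) + d * c ^+ size r)
  = d * c ^+ size r * (c - 1) by ring.
by rewrite !mulr_ge0 ?exprn_ge0 ?subr_ge0.
Qed.

(** Only the first matrix is assumed bounded: with [d <= 1] the second one is
    bounded by [c + 1]. *)
Lemma det_close (R : realType) n (c e : R) : 0 < e ->
  exists2 d : R, 0 < d & forall A B : 'M[R[i]]_n,
    (forall i j, normc (A i j) <= c) -> (forall i j, normc (A i j - B i j) <= d) ->
    normc (\det A - \det B) <= e.
Proof.
move=> e0; pose c' := Num.max c 0 + 1.
have c'1 : 1 <= c' by rewrite lerDr le_max lexx orbT.
have cc' : c + 1 <= c' by rewrite lerD2r le_max lexx.
pose K : R := #|{: {perm 'I_n}}|%:R * (n%:R * c' ^+ n).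
have K0 : 0 <= K by rewrite !mulr_ge0 ?exprn_ge0 //; lra.
pose d := Num.min 1 (e / (K + 1)).
have K10 : 0 < K + 1 by lra.
have d0 : 0 < d by rewrite lt_min ltr01 divr_gt0.
have d1 : d <= 1 by rewrite ge_min lexx.
have dK : d * (K + 1) <= e by rewrite -ler_pdivlMr // ge_min lexx orbT.
exists d => // A B Ac AB; apply: (@le_trans _ _ (d * K)); last by nra.
rewrite -sumrB; apply: le_trans (normc_sum _ _ _) _.
have -> : d * K = \sum_(s : {perm 'I_n}) d * (n%:R * c' ^+ n).
  by rewrite sumr_const /K -mulr_natl; ring.
apply: ler_sum => s _; rewrite -mulrBr normcM normcX normcN normc1 expr1n mul1r.
have := @prod_lipschitz R _ (index_enum 'I_n) (fun i => A i (s i))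
  (fun i => B i (s i)) c' d c'1 (ltW d0).
have -> : size (index_enum 'I_n) = n by rewrite -sum1_size big_const_ord iter_addn_0 mul1n.
apply=> // i; first by apply: le_trans (Ac _ _) _; lra.
have := AB i (s i); have := Ac i (s i); have := lerB_normc (B i (s i)) (A i (s i)).
by rewrite normcB; lra.
Qed.

(** * Lower bounds for polynomials and resolvents *)

Lemma seq_positive_gap (R : realType) (s : seq R) (c : R) : 0 < c ->
  (forall x, x \in s -> 0 < x) ->
  exists d : R, [/\ 0 < d, d <= c & forall x, x \in s -> d <= x].
Proof.
move=> c0; elim: s => [|x s IH] s_gt0; first by exists c.
have [|d [d0 dc ds]] := IH.
  by move=> y ys; apply: s_gt0; rewrite inE ys orbT.
have x0 : 0 < x by apply: s_gt0; rewrite mem_head.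
exists (Num.min d x); split; rewrite ?lt_min ?d0 ?ge_min ?dc //.
by move=> y; rewrite inE => /predU1P[->|/ds]; rewrite ge_min ?lexx ?orbT // => ->.
Qed.

(** Take for rho half the smallest positive distance from a root to the centre,
    capped by [r0]: then every root, possibly the centre itself, is at
    distance at least rho from the circle. *)
Lemma poly_circle_lower_bound (R : realType) (p : {poly R[i]}) (a : R[i]) (r0 : R) :
  p != 0 -> 0 < r0 ->
  exists rho : R, [/\ 0 < rho, rho < r0 & exists2 m : R, 0 < m &
    forall z, normc (z - a) = rho -> m <= normc p.[z]].
Proof.
move=> p0 r00; have [rs def_p] := closed_field_poly_normal p.
have [|d [d0 dr ds]] :=
    @seq_positive_gap R [seq x <- [seq normc (r - a) | r <- rs] | 0 < x] r0 r00.
  by move=> x; rewrite mem_filter => /andP[].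
exists (d / 2); split; [by lra|by lra|].
exists (normc (lead_coef p) * (d / 2) ^+ size rs).
  by rewrite mulr_gt0 ?normc_gt0 ?lead_coef_eq0 // exprn_gt0; lra.
move=> z za; rewrite {2}def_p hornerZ normcM ler_wpM2l ?normc_ge0 //.
rewrite horner_prod normc_prod -prodr_const_seq big_seq [leRHS]big_seq.
apply: ler_prod => r rin; rewrite (divr_ge0 (ltW d0)) //= hornerXsubC.
have [ra|] := eqVneq r a; first by rewrite ra za.
rewrite -subr_eq0 -normc_gt0 => ra0.
have /ds : normc (r - a) \in [seq x <- [seq normc (r - a) | r <- rs] | 0 < x].
  by rewrite mem_filter ra0; apply: (map_f (fun r : R[i] => normc (r - a))) rin.
have := normc_trisub z r a; rewrite za (normcB r z); lra.
Qed.

Lemma horner_char_poly (F : fieldType) n (A : 'M[F]_n) (v : F) :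
  (char_poly A).[v] = \det (v%:M - A).
Proof.
rewrite -[LHS]/(horner_eval v (char_poly A)) -det_map_mx; congr (\det _).
by apply/matrixP => i j; rewrite !mxE /= horner_evalE !(hornerD,hornerN,hornerC,hornerMn,hornerX).
Qed.

(** The determinant is the product of the (v - r) / v over the eigenvalues r.
    If g is a gap between the Re r and 1, then |v - r| >= g / 2 on the
    half-plane, so |v| <= |v - r| + |r| <= |v - r| (1 + 2 |r| / g): each factor
    is bounded below uniformly in v, also as v goes to infinity. *)
Lemma det_scaled_resolvent_lower_bound (R : realType) n (A : 'M[R[i]]_n) :
  (forall z, root (char_poly A) z -> complex.Re z < 1) ->
  exists d : R, [/\ 0 < d, d <= 2^-1 & exists2 m : R, 0 < m &
    forall v, 1 - d <= complex.Re v -> m <= normc (\det (1%:M - v^-1 *: A))].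
Proof.
move=> specA; have [rs def_p] := closed_field_poly_normal (char_poly A).
rewrite (monicP (char_poly_monic A)) scale1r in def_p.
have szrs : size rs = n.
  have := size_char_poly A; rewrite def_p size_prod_XsubC => -[].
  by [].
have half0 : 0 < 2^-1 :> R by rewrite invr_gt0.
have [|g [g0 g2 gs]] :=
    @seq_positive_gap R [seq 1 - complex.Re r | r <- rs] 2^-1 half0.
  move=> x /mapP[r rin ->]; rewrite subr_gt0; apply: specA.
  by rewrite def_p root_prod_XsubC.
exists (g / 2); split; [by lra|by lra|].
exists (\prod_(r <- rs) (1 + normc r / (g / 2))^-1).
  apply: prodr_gt0 => r _; rewrite invr_gt0 ltr_pwDl // divr_ge0 ?normc_ge0 //; lra.
move=> v vd; have v0 : v != 0.
  by apply/eqP => v0; move: vd; rewrite v0 /=; lra.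
have -> : \det (1%:M - v^-1 *: A) = \prod_(r <- rs) (v^-1 * (v - r)).
  rewrite big_split /= prodr_const_seq szrs.
  have -> : \prod_(r <- rs) (v - r) = (char_poly A).[v].
    by rewrite def_p horner_prod; apply: eq_bigr => r _; rewrite hornerXsubC.
  rewrite horner_char_poly -detZ; congr (\det _).
  by rewrite scalerBr scale_scalar_mx mulVf.
rewrite normc_prod big_seq [leRHS]big_seq; apply: ler_prod => r rin.
have nr := normc_ge0 r.
have q0 : 0 <= normc r / (g / 2) by rewrite divr_ge0 //; lra.
rewrite invr_ge0 addr_ge0 //= normcM normcV.
rewrite [leRHS]mulrC ler_pdivlMr ?normc_gt0 // mulrC ler_pdivrMr; last by lra.
have far : g / 2 <= normc (v - r).
  have := gs _ (map_f _ rin); have := Re_le_normc (v - r).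
  by rewrite raddfB /=; lra.
have : normc r <= normc (v - r) * (normc r / (g / 2)).
  by rewrite mulrA ler_pdivlMr ?divr_gt0 // mulrC ler_wpM2r.
have := lerB_normc v r; rewrite mulrDr mulr1.
have := lerB_normc v (v - r); rewrite subKr; lra.
Qed.

(** * Small filter time constants *)

Lemma mx_uniform_bound (R : realType) n (S : R[i] -> Prop) (G : R[i] -> 'M[R[i]]_n) :
  (forall i j, exists M : R, forall z, S z -> normc (G z i j) <= M) ->
  exists2 M : R, 0 <= M & forall z i j, S z -> normc (G z i j) <= M.
Proof.
move=> GM; pose M i j := Num.max 0 (projT1 (cid (GM i j))).
have M0 i j : 0 <= M i j by rewrite le_max lexx.
exists (\sum_i \sum_j M i j) => [|z i j Sz]; first by do 2!apply: sumr_ge0 => ? _.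
apply: (@le_trans _ _ (M i j)).
  by rewrite le_max; case: (cid (GM i j)) => /= x ->; rewrite ?orbT.
rewrite (bigD1 i) //= (bigD1 j) //= -addrA lerDl addr_ge0 ?sumr_ge0 // => k _.
by rewrite sumr_ge0.
Qed.

(** The variable is rescaled to s = z T.  The determinant g below is entire in s
    and O(T)-close, on a disk around a = mu - 1 inside Re s > 0, to P(s) =
    s^N det ((s + 1) I - D); P is nonzero on the boundary circle and P(a) = 0,
    so g has a zero s with Re s > 0. *)
Lemma filtered_loop_unstable (R : realType) N (D : 'M[R[i]]_N)
    (L : R[i] -> 'M[R[i]]_N) (mu : R[i]) :
  (forall i j, entire (fun z => L z i j)) ->
  (forall i j, exists b : R, forall z, 0 <= complex.Re z -> normc (L z i j) <= b) ->
  eigenvalue D mu -> 1 < complex.Re mu ->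
  exists That : R, 0 < That /\ forall T : R, 0 < T -> T < That ->
    unstable (fun z =>
      \det (z *: (1%:M - (z * T%:C + 1)^-1 *: D) - L z)).
Proof.
move=> eL Lb muD mu1; set a := mu - 1.
have Rea : 0 < complex.Re a by rewrite /a raddfB /= subr_gt0.
(* det (s I - (D - I)) = det ((s + 1) I - D), so that P is visibly monic. *)
pose P : {poly R[i]} := 'X^N * char_poly (D - 1%:M).
have P0 : P != 0.
  by rewrite monic_neq0 // monicMl ?monicXn // char_poly_monic.
have PE s : P.[s] = \det (s *: ((s + 1)%:M - D)).
  rewrite /P hornerM hornerXn horner_char_poly detZ; congr (_ * \det _).
  by rewrite opprB addrA raddfD.
have Pa : P.[a] = 0.
  rewrite PE detZ -horner_char_poly /a subrK.
  by move: muD; rewrite eigenvalue_root_char => /rootP ->; rewrite mulr0.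
have [rho [rho0 rhoa [m m0 Pm]]] := poly_circle_lower_bound a P0 Rea.
have eE i j : entire (fun s : R[i] => (s *: ((s + 1)%:M - D)) i j).
  apply: (@eq_entire R (fun s => s * ((s + 1) * (i == j)%:R - D i j))).
    by move=> s; rewrite !mxE mulr_natr.
  apply: entireM; first exact: entire_id.
  apply: entireB; last exact: entire_cst.
  apply: entireM; last exact: entire_cst.
  apply: entireD; [exact: entire_id|exact: entire_cst].
have [c c0 Ec] : exists2 c : R, 0 <= c & forall s i j, normc s <= normc a + rho ->
    normc ((s *: ((s + 1)%:M - D)) i j) <= c.
  apply: mx_uniform_bound => i j.
  by have [M [_ MP]] := entire_bounded (normc a + rho) (eE i j); exists M.
have [b b0 bL] := mx_uniform_bound Lb.
(* With errors at most m / 6, 2 |g a| <= m / 3 < m - m / 6 <= |g| on the circle. *)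
have m6 : 0 < m / 6 by rewrite divr_gt0.
have [d d0 dP] := det_close N c m6.
have S0 : 0 <= normc a + rho + 1 by have := normc_ge0 a; lra.
have Q0 : 0 <= (normc a + rho + 1) * b by rewrite mulr_ge0.
exists (Num.min 1 (d / ((normc a + rho + 1) * b + 1))).
split; first by rewrite lt_min ltr01 divr_gt0 //; lra.
move=> T T0; rewrite lt_min => /andP[_ Td].
pose g s := \det (s *: ((s + 1)%:M - D) - ((s + 1) * T%:C) *: L (T^-1%:C * s)).
have eg : entire g.
  apply: entire_det => i j.
  apply: (@eq_entire R (fun s => (s *: ((s + 1)%:M - D)) i j
      - ((s + 1) * T%:C) * L (T^-1%:C * s) i j)).
    by move=> s; rewrite !mxE.
  apply: entireB => //; apply: entireM; last exact: (@entire_scale R (fun z => L z i j)).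
  apply: entireM; last exact: entire_cst.
  apply: entireD; [exact: entire_id|exact: entire_cst].
have close s : normc (s - a) <= rho -> normc (P.[s] - g s) <= m / 6.
  move=> sa; have ns : normc s <= normc a + rho by have := lerB_normc s a; lra.
  rewrite PE; apply: dP => i j; first exact: Ec.
  have -> : (s *: ((s + 1)%:M - D)) i j -
     (s *: ((s + 1)%:M - D) - ((s + 1) * T%:C) *: L (T^-1%:C * s)) i j
     = (s + 1) * T%:C * L (T^-1%:C * s) i j by rewrite !mxE; ring.
  have Res : 0 <= complex.Re s.
    have := normr_Re_le (s - a); rewrite raddfB /= => /le_trans/(_ sa).
    by rewrite ler_distl => /andP[]; lra.
  have Res' : 0 <= complex.Re (T^-1%:C * s).
    by case: (s) Res => x y /= x0; rewrite mul0r subr0 mulr_ge0 // invr_ge0 ltW.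
  rewrite 2!normcM normcC gtr0_norm // mulrAC.
  apply: (@le_trans _ _ ((normc a + rho + 1) * b * T)).
    rewrite ler_wpM2r ?(ltW T0) // ler_pM ?normc_ge0 ?bL //.
    by apply: le_trans (le_normcD _ _) _; rewrite normc1 lerD2r.
  move: Td; rewrite ltr_pdivlMr; last by lra.
  by nra.
have [||s sRe gs] := @entire_has_zero R g a rho (m - m / 6) eg rho0.
- move=> s sa; have := close s; rewrite sa => /(_ (lexx _)).
  by have := Pm s sa; have := lerB_normc P.[s] (g s); lra.
- have := close a; rewrite subrr normc0 => /(_ (ltW rho0)).
  by rewrite Pa sub0r normcN; lra.
have Res : 0 < complex.Re s by lra.
have TC : T%:C != 0 by rewrite (fmorph_eq0 (real_complex R)) gt_eqF.
have v0 : s + 1 != 0.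
  apply/eqP => /(congr1 (@complex.Re R)); rewrite raddfD /=; lra.
exists (T^-1%:C * s); split; last first.
  by case: (s) Res => x y /= x0; rewrite mul0r subr0 mulr_gt0 // invr_gt0.
have sT : T^-1%:C * s * T%:C = s by rewrite fmorphV mulrAC mulVf ?mul1r.
(* The factor (s + 1) T turns the filtered matrix at s / T into that of g. *)
rewrite sT; apply/eqP; rewrite -(@mulrI_eq0 _ (((s + 1) * T%:C) ^+ N)); last first.
  by apply/lregX/lregP; rewrite mulf_neq0.
rewrite -detZ -gs; apply/eqP; congr (\det _).
rewrite scalerBr scalerA; congr (_ - _).
rewrite -mulrA (mulrC T%:C) sT mulrC -scalerA scalerBr scalerA divff // scale1r.
by rewrite scale_scalar_mx mulr1.
Qed.

(** The regime |z| > R0 is controlled by the eigenvalues of D alone, as L(z) / z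
    is small there; the regime |z| <= R0 by the nominal loop, as 1 / (z T + 1)
    tends to 1 on bounded sets.  The
    stability margin obtained can be any c < c0 and is independent of T. *)
Lemma filtered_loop_stable (R : realType) N (D : 'M[R[i]]_N)
    (L : R[i] -> 'M[R[i]]_N) :
  (forall i j, entire (fun z => L z i j)) ->
  (forall c i j, exists b : R, forall z, - c <= complex.Re z -> normc (L z i j) <= b) ->
  (forall z, eigenvalue D z -> complex.Re z < 1) ->
  exp_stable (fun z => \det (z *: (1%:M - D) - L z)) ->
  exists That : R, 0 < That /\ forall T : R, 0 < T -> T < That ->
    exp_stable (fun z =>
      \det (z *: (1%:M - (z * T%:C + 1)^-1 *: D) - L z)).
Proof.
move=> eL Lb specD [c0 [c00 stab0]].
have [|dl [dl0 dl2 [m m0 resm]]] := @det_scaled_resolvent_lower_bound R N D.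
  by move=> z; rewrite -eigenvalue_root_char; exact: specD.
have [c cgt0 cc0] : exists2 c : R, 0 < c & c < c0 by exists (c0 / 2); lra.
have [b b0 bL] := mx_uniform_bound (Lb c).
have [dD dD0 Db] : exists2 M : R, 0 <= M & forall (z : R[i]) i j, True -> normc (D i j) <= M.
  by apply: (@mx_uniform_bound R N (fun=> True) (fun=> D)) => i j; exists (normc (D i j)).
have inv2 v : 1 - dl <= complex.Re v -> normc v^-1 <= 2.
  move=> vd; have vge : 2^-1 <= normc v by have := Re_le_normc v; lra.
  rewrite normcV -[leRHS]invrK lef_pV2 // posrE ?invr_gt0 //.
  by apply: lt_le_trans vge; rewrite invr_gt0.
have m2 : 0 < m / 2 by rewrite divr_gt0.
have [d1 d10 d1P] := det_close N (1 + 2 * dD) m2.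
(* For |z| > R0 the entries of L(z) / z are at most b / |z| <= d1. *)
have [R0 R00 R0E] : exists2 R0 : R, 0 < R0 & b < d1 * R0.
  exists ((b + 1) / d1); first by rewrite divr_gt0 //; lra.
  by rewrite mulrC divfK ?gt_eqF //; lra.
pose M0 z := z *: (1%:M - D) - L z.
have eM0 i j : entire (fun z => M0 z i j).
  apply: (@eq_entire R (fun z => z * (1%:M - D) i j - L z i j)).
    by move=> z; rewrite !mxE.
  apply: entireB => //; apply: entireM; [exact: entire_id|exact: entire_cst].
have [|m1 m10 boxm] := @entire_box_lower_bound R _ (- c) R0 (- R0) R0 (entire_det eM0).
  move=> z /andP[zc _] _; apply/eqP => /stab0.
  by rewrite leNgt => /negP; apply; apply: lt_le_trans zc; rewrite ltrN2.
have [c1 c10 M0c] : exists2 c1 : R, 0 <= c1 & forall z i j, normc z <= R0 ->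
    normc (M0 z i j) <= c1.
  apply: mx_uniform_bound => i j.
  by have [M [_ MP]] := entire_bounded R0 (eM0 i j); exists M.
have m12 : 0 < m1 / 2 by rewrite divr_gt0.
have [d2 d20 d2P] := det_close N c1 m12.
have Q0 : 0 <= R0 * R0 * 2 * dD by rewrite !mulr_ge0 ?(ltW R00).
exists (Num.min (dl / c) (d2 / (R0 * R0 * 2 * dD + 1))); split.
  by rewrite lt_min !divr_gt0 //; lra.
move=> T T0; rewrite lt_min => /andP[Tc Td].
exists c; split=> // z Hz; rewrite leNgt; apply/negP => zc.
have vd : 1 - dl <= complex.Re (z * T%:C + 1).
  have : - c * T <= complex.Re z * T by rewrite ler_wpM2r ?(ltW T0) ?(ltW zc).
  move: Tc; rewrite ltr_pdivlMr //.
  by case: (z) => x y /=; rewrite mulr0 subr0; lra.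
set v := z * T%:C + 1 in Hz vd; have v0 : v != 0.
  by apply/eqP => v0; move: vd; rewrite v0 /=; lra.
(* The difference to the nominal matrix is z (z T) / v times D, of size O(T). *)
have [zR0|zR0] := leP (normc z) R0.
  have := d2P (M0 z) (z *: (1%:M - v^-1 *: D) - L z) (fun i j => M0c z i j zR0).
  rewrite Hz subr0 => /(_ _)/wrap[].
    move=> i j.
    have -> : M0 z i j - (z *: (1%:M - v^-1 *: D) - L z) i j
        = z * (z * T%:C) * v^-1 * - D i j.
      have -> : z * T%:C = v - 1 by rewrite /v addrK.
      by rewrite !mxE; field.
    rewrite !normcM normcN normcC gtr0_norm //.
    apply: (@le_trans _ _ (R0 * (R0 * T) * 2 * dD)).
      rewrite ler_pM ?mulr_ge0 ?normc_ge0 ?(ltW T0) ?(Db 0) //.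
      rewrite ler_pM ?mulr_ge0 ?normc_ge0 ?(ltW T0) ?inv2 //.
      rewrite ler_pM ?mulr_ge0 ?normc_ge0 ?(ltW T0) //.
      by rewrite ler_wpM2r ?(ltW T0).
    by move: Td; rewrite ltr_pdivlMr; [nra|lra].
  have zRe := Re_le_normc z; have zIm := normr_Im_le z.
  have /(_ _)/wrap[|] := boxm z; first by apply/andP; split; lra.
  by rewrite -ler_norml => /(_ (le_trans zIm zR0)); lra.
have z0 : z != 0 by rewrite -normc_gt0; lra.
have Hz' : \det (1%:M - v^-1 *: D - z^-1 *: L z) = 0.
  have -> : 1%:M - v^-1 *: D - z^-1 *: L z
      = z^-1 *: (z *: (1%:M - v^-1 *: D) - L z).
    by rewrite scalerBr scalerA mulVf // scale1r.
  by rewrite detZ Hz mulr0.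
have := resm v vd.
have := d1P (1%:M - v^-1 *: D) (1%:M - v^-1 *: D - z^-1 *: L z).
rewrite Hz' subr0 => /(_ _ _)/wrap[||]; last by lra.
  move=> i j; rewrite !mxE; apply: le_trans (le_normcD _ _) _; apply: lerD.
    by case: (i == j); rewrite ?mulr1n ?mulr0n ?normc1 ?normc0.
  by rewrite normcN normcM ler_pM ?normc_ge0 ?inv2 ?(Db 0).
move=> i j.
have -> (X Y : 'M[R[i]]_N) : X i j - (X - Y) i j = Y i j.
  by rewrite !mxE subKr.
rewrite mxE normcM normcV mulrC ler_pdivrMr ?normc_gt0 //.
apply: (@le_trans _ _ b); first by apply: bL; exact: ltW.
by have := ltW zR0; rewrite -(ler_pM2l d10); lra.
Qed.

(** * The delay loop *)

Lemma mxC_sub (R : realType) m n (A B : 'M[R]_(m, n)) :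
  mxC (A - B) = mxC A - mxC B.
Proof. by apply/matrixP => i j; rewrite !mxE rmorphB. Qed.

Lemma mxC1 (R : realType) n : mxC (1%:M : 'M[R]_n) = 1%:M.
Proof. exact: (map_mx1 (real_complex R)). Qed.

Lemma eigenvalue_shift (F : fieldType) n (A : 'M[F]_n) (a z : F) :
  eigenvalue A z -> eigenvalue (A - a%:M) (z - a).
Proof.
move=> /eigenvalueP[v vA v0]; apply/eigenvalueP; exists v => //.
by rewrite mulmxBr vA mul_mx_scalar scalerBl.
Qed.

(** The integrator states add the eigenvalue 0 only; it lies in Re < 1, so the
    padding affects neither of the two spectral hypotheses. *)
Lemma eigenvalue_block_diag0 (F : fieldType) n q (A : 'M[F]_n) (z : F) :
  eigenvalue (block_mx A 0 0 (0 : 'M_q)) z = eigenvalue A z || (z == 0) && (0 < q)%N.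
Proof.
rewrite !eigenvalue_root_char /char_poly char_block_diag_mx det_ublock.
rewrite rootM -!/(char_poly _); congr (_ || _).
by rewrite /root horner_char_poly subr0 det_scalar expf_eq0 andbC.
Qed.

Lemma entire_loop_mx (R : realType) (n m p q K : nat)
    (A0 : 'M[R]_n) (A : 'I_K -> 'M[R]_n) (tau : 'I_K -> R)
    (B : 'M[R]_(n, m)) (C : 'M[R]_(p, n)) (Kp : 'M[R]_(m, p))
    (Ui : 'M[R]_(m, q)) (Vi : 'M[R]_(q, p)) i j :
  entire (fun z => loop_mx A0 A tau B C Kp Ui Vi z i j).
Proof.
apply: eq_entire => [z|]; first by rewrite mxE summxE.
apply: entireD; first exact: entire_cst.
apply: entire_sum => k.
apply: (@eq_entire R (fun z => cexp (- (tau k)%:C * z) *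
  mxC (block_mx (A k) 0 0 (0 : 'M_q)) i j)).
  by move=> z; rewrite [RHS]mxE !mulNr (mulrC z).
by apply: entireM; [exact: entire_scale (@entire_cexp R)|exact: entire_cst].
Qed.

Lemma loop_mx_bounded (R : realType) (n m p q K : nat)
    (A0 : 'M[R]_n) (A : 'I_K -> 'M[R]_n) (tau : 'I_K -> R)
    (B : 'M[R]_(n, m)) (C : 'M[R]_(p, n)) (Kp : 'M[R]_(m, p))
    (Ui : 'M[R]_(m, q)) (Vi : 'M[R]_(q, p)) (c : R) i j :
  (forall k, 0 < tau k) ->
  exists b : R, forall z, - c <= complex.Re z ->
    normc (loop_mx A0 A tau B C Kp Ui Vi z i j) <= b.
Proof.
move=> tau_gt0.
exists (normc (mxC (block_mx (A0 + B *m Kp *m C) (B *m Ui) (Vi *m C) 0) i j)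
  + \sum_(k < K) expR (c * tau k) * normc (mxC (block_mx (A k) 0 0 (0 : 'M_q)) i j)).
move=> z zc; rewrite mxE summxE; apply: le_trans (le_normcD _ _) _.
rewrite lerD2l; apply: le_trans (normc_sum _ _ _) _; apply: ler_sum => k _.
rewrite [X in normc X]mxE normcM normc_cexp ler_wpM2r ?normc_ge0 // ler_expR.
have := ler_wpM2r (ltW (tau_gt0 k)) zc.
by case: (z) => x y /=; rewrite mulr0 subr0; lra.
Qed.

Theorem proposition4p1 (R : realType) (n m p q K : nat)
    (A0 : 'M[R]_n) (A : 'I_K -> 'M[R]_n) (tau : 'I_K -> R)
    (B : 'M[R]_(n, m)) (C : 'M[R]_(p, n))
    (Kp Kd Ki : 'M[R]_(m, p)) (Ui : 'M[R]_(m, q)) (Vi : 'M[R]_(q, p))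
    (tau_pos : forall k, 0 < tau k)
    (tau_incr : forall j k : 'I_K, (j < k)%N -> tau j < tau k)
    (rankB : \rank B = m) (rankC : \rank C = p)
    (rankKi : q = \rank Ki) (factKi : Ki = Ui *m Vi)
    (rankUi : \rank Ui = q) (rankVi : \rank Vi = q)
    (stable0 : exp_stable (char_nominal A0 A tau B C Kp Kd Ui Vi)) :
  ((exists z : R[i], eigenvalue (mxC (B *m Kd *m C)) z /\ 1 < complex.Re z) ->
   exists That : R, 0 < That /\
     forall T : R, 0 < T -> T < That ->
       unstable (char_filtered A0 A tau B C Kp Kd Ui Vi T))
  /\
  (hurwitz (B *m Kd *m C - 1%:M) ->
   exists That : R, 0 < That /\
     forall T : R, 0 < T -> T < That ->
       exp_stable (char_filtered A0 A tau B C Kp Kd Ui Vi T)).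
Proof.
pose D := mxC (block_mx (B *m Kd *m C) 0 0 (0 : 'M_q)).
pose L := loop_mx A0 A tau B C Kp Ui Vi.
have DE : D = block_mx (mxC (B *m Kd *m C)) 0 0 0 by rewrite /D /mxC map_block_mx !map_mx0.
have specD z : eigenvalue D z = eigenvalue (mxC (B *m Kd *m C)) z || (z == 0) && (0 < q)%N.
  by rewrite DE eigenvalue_block_diag0.
have eL i j : entire (fun z => L z i j) by exact: entire_loop_mx.
have bL c i j : exists b : R, forall z, - c <= complex.Re z -> normc (L z i j) <= b.
  exact: loop_mx_bounded.
have oneE : mxC (block_mx 1%:M 0 0 (1%:M : 'M[R]_q)) = 1%:M :> 'M_(n + q).
  by rewrite -scalar_mx_block mxC1.
have nominalE z : char_nominal A0 A tau B C Kp Kd Ui Vi z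
    = \det (z *: (1%:M - D) - L z).
  rewrite -oneE /D -mxC_sub opp_block_mx add_block_mx.
  by rewrite !oppr0 !addr0.
have filteredE T z : char_filtered A0 A tau B C Kp Kd Ui Vi T z
    = \det (z *: (1%:M - (z * T%:C + 1)^-1 *: D) - L z).
  by rewrite /char_filtered oneE.
split=> [[mu [muD mu1]]|hurD].
  have bL0 i j : exists b : R, forall z, 0 <= complex.Re z -> normc (L z i j) <= b.
    by have := bL 0 i j; rewrite oppr0.
  have muD' : eigenvalue D mu by rewrite specD muD.
  have [That [That0 HT]] := filtered_loop_unstable eL bL0 muD' mu1.
  exists That; split=> // T T0 TT; have [z [Hz z0]] := HT T T0 TT.
  by exists z; rewrite filteredE.
have specD1 z : eigenvalue D z -> complex.Re z < 1.
  rewrite specD => /orP[zD|/andP[/eqP -> _]]; last exact: ltr01.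
  have := hurD (z - 1); rewrite mxC_sub mxC1 => /(_ (eigenvalue_shift 1 zD)).
  by rewrite raddfB /= subr_lt0.
have stableD : exp_stable (fun z => \det (z *: (1%:M - D) - L z)).
  have [c [c0 Hc]] := stable0; exists c; split=> // z Hz.
  by apply: Hc; rewrite nominalE.
have [That [That0 HT]] := filtered_loop_stable eL bL specD1 stableD.
exists That; split=> // T T0 TT; have [c [c0 Hc]] := HT T T0 TT.
by exists c; split=> // z; rewrite filteredE; exact: Hc.
Qed.
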